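(* Under the standing assumptions, suppose in addition that $P_{1,n+1}(a)$ is invertible. Then for every $z\in\mathbb C\setminus\{b\}$, \begin{align*} U^{(2n+1)}(z)=&\begin{pmatrix}\frac{1}{b-z}I_q&0_q\\0_q&I_q\end{pmatrix}\Bigg[\overrightarrow{\prod_{k=0}^{n}}\begin{pmatrix}I_q&\mathbf l_{k-1}\\0_q&I_q\end{pmatrix}\begin{pmatrix}I_q&0_q\\-(z-a)\mathbf m_k&I_q\end{pmatrix}\Bigg]\\ &\cdot\begin{pmatrix}I_q&-\Gamma_{1,n}(a)^{-1}\Theta_{1,n}(a)-(b-a)P_{1,n+1}(a)^{-1}Q_{1,n+1}(a)\\0_q&I_q\end{pmatrix}\begin{pmatrix}(b-z)I_q&0_q\\0_q&I_q\end{pmatrix}, \end{align*} where $\overrightarrow{\prod_{k=0}^{n}}A_k:=A_0A_1\cdots A_{n}$.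
   Context: Let $q,n\in\mathbb N$ and let $a<b$ be real numbers. All matrices are complex; $I_q$, $0_q$ are the $q\times q$ identity and zero matrices; for a matrix-valued function $F$, $F^*(\bar z)$ means $(F(\bar z))^*$. Let $s_0,\dots,s_{2n+1}$ be Hermitian $q\times q$ matrices and set $\widehat s_j:=-ab\,s_j+(a+b)s_{j+1}-s_{j+2}$. Define $H_{1,j}:=(s_{l+k})_{l,k=0}^j$, $H_{2,j}:=(\widehat s_{l+k})_{l,k=0}^{j}$, $K_{1,j}:=(bs_{l+k}-s_{l+k+1})_{l,k=0}^{j}$, $K_{2,j}:=(-as_{l+k}+s_{l+k+1})_{l,k=0}^j$. Standing assumption: $H_{1,n},H_{2,n-1},K_{1,n},K_{2,n}$ are positive definite. Let $T_0:=0_q$ and, for $j\ge1$, let $T_j$ be the $(j+1)\times(j+1)$ block matrix (blocks $q\times q$) with $I_q$ in block positions $(l+1,l)$, $l=0,\dots,j-1$, and $0_q$ elsewhere; $R_j(z):=(I_{(j+1)q}-zT_j)^{-1}$; $v_j:=\mathrm{col}(I_q,0_q,\dots,0_q)\in\mathbb C^{(j+1)q\times q}$. Let $u_{1,j}:=\mathrm{col}(0_q,-s_0,\dots,-s_{j-1})$, $u_{2,0}:=-(a+b)s_0+s_1$, $u_{2,j}:=\mathrm{col}(u_{2,0},-\widehat s_0,\dots,-\widehat s_{j-1})$, $\widetilde u_{1,j}:=\mathrm{col}(s_0,s_1-bs_0,\dots,s_j-bs_{j-1})$; for $j\ge1$, $Y_{1,j}:=\mathrm{col}(s_j,\dots,s_{2j-1})$,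 $Y_{2,j}:=\mathrm{col}(\widehat s_j,\dots,\widehat s_{2j-1})$, $\widetilde Y_{1,j}:=\mathrm{col}(bs_j-s_{j+1},\dots,bs_{2j-1}-s_{2j})$. Polynomials: $P_{2,0}:=I_q$, $Q_{2,0}(z):=-(u_{2,0}+zs_0)$, $\Gamma_{1,0}:=I_q$, $\Theta_{1,0}:=s_0$; for $j\ge1$: $P_{2,j}(z):=(-Y_{2,j}^*H_{2,j-1}^{-1},I_q)R_j(z)v_j$, $Q_{2,j}(z):=-(-Y_{2,j}^*H_{2,j-1}^{-1},I_q)R_j(z)(u_{2,j}+zv_js_0)$, $\Gamma_{1,j}(z):=(-\widetilde Y_{1,j}^*K_{1,j-1}^{-1},I_q)R_j(z)v_j$, $\Theta_{1,j}(z):=(-\widetilde Y_{1,j}^*K_{1,j-1}^{-1},I_q)R_j(z)\widetilde u_{1,j}$; for $1\le j\le n+1$: $P_{1,j}(z):=(-Y_{1,j}^*H_{1,j-1}^{-1},I_q)R_j(z)v_j$, $Q_{1,j}(z):=-(-Y_{1,j}^*H_{1,j-1}^{-1},I_q)R_j(z)u_{1,j}$. DSM parameters: $\lambda_j:=(u_{2,j}+av_js_0)^*R_j(a)^*H_{2,j}^{-1}R_j(a)(u_{2,j}+av_js_0)$, $\mu_j:=v_j^*R_j(a)^*K_{1,j}^{-1}R_j(a)v_j$; $\mathbf l_{-1}:=s_0$, $\mathbf l_0:=\lambda_0$, $\mathbf l_j:=\lambda_j-\lambda_{j-1}$ ($1\le j\le n-1$); $\mathbf m_0:=\mu_0$,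 $\mathbf m_j:=\mu_j-\mu_{j-1}$ ($1\le j\le n$). Resolvent matrix (odd case): $U^{(2n+1)}(z):=\begin{pmatrix}Q_{2,n}^*(\bar z)Q_{2,n}(a)^{*-1} & -Q_{1,n+1}^*(\bar z)P_{1,n+1}(a)^{*-1}\\ -(z-a)(b-z)P_{2,n}^*(\bar z)Q_{2,n}(a)^{*-1} & P_{1,n+1}^*(\bar z)P_{1,n+1}(a)^{*-1}\end{pmatrix}$, where $X^{*-1}:=(X^* )^{-1}$ (the invertibility of $\Gamma_{1,n}(a)$ and $Q_{2,n}(a)$ holds under the standing assumptions). *)

(* Defs.v *)
From HB Require Import structures.
From mathcomp Require Import all_boot all_order all_algebra.
Set Implicit Arguments. Unset Strict Implicit. Unset Printing Implicit Defensive.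
Import Order.TTheory GRing.Theory Num.Theory.
Local Open Scope ring_scope.

Section Defs.
Variable C : numClosedFieldType.

Definition adj (m p : nat) (A : 'M[C]_(m, p)) : 'M[C]_(p, m) :=
  (map_mx Num.conj A)^T.

Definition posdef (m : nat) (A : 'M[C]_m) : Prop :=
  adj A = A /\ forall x : 'cV[C]_m, x != 0 -> 0 < (adj x *m A *m x) 0 0.

Variable q : nat.
Local Notation M := 'M[C]_q.

Definition bentry (A : M) (r c : nat) : C :=
  if (insub r : option 'I_q) is Some r' then
    if (insub c : option 'I_q) is Some c' then A r' c' else 0
  else 0.

Definition bmx (m p : nat) (B : nat -> nat -> M) : 'M[C]_(m * q, p * q) :=
  \matrix_(i, k) bentry (B (i %/ q)%N (k %/ q)%N) (i %% q)%N (k %% q)%N.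

Definition bcol (m : nat) (B : nat -> M) : 'M[C]_(m * q, q) :=
  \matrix_(i, k) bentry (B (i %/ q)%N) (i %% q)%N k.

Definition browYH (j : nat) (Y : 'M[C]_(j * q, q)) (H : 'M[C]_(j * q))
  : 'M[C]_(q, j.+1 * q) :=
  castmx (erefl q, esym (mulSnr j q)) (row_mx (- (adj Y *m invmx H)) 1%:M).

Definition Tmx (j : nat) : 'M[C]_(j.+1 * q) :=
  bmx j.+1 j.+1 (fun l k => if l == k.+1 then 1%:M else 0).
Definition Rmx (j : nat) (z : C) : 'M[C]_(j.+1 * q) :=
  invmx (1%:M - z *: Tmx j).
Definition vmx (j : nat) : 'M[C]_(j.+1 * q, q) :=
  bcol j.+1 (fun l => if l == 0%N then 1%:M else 0).

Variables (a b : C) (s : nat -> M).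

Definition shat (j : nat) : M := - (a * b) *: s j + (a + b) *: s j.+1 - s j.+2.

Definition H1 (j : nat) : 'M[C]_(j.+1 * q) := bmx j.+1 j.+1 (fun l k => s (l + k)).
Definition H2 (j : nat) : 'M[C]_(j.+1 * q) := bmx j.+1 j.+1 (fun l k => shat (l + k)).
Definition K1 (j : nat) : 'M[C]_(j.+1 * q) :=
  bmx j.+1 j.+1 (fun l k => b *: s (l + k) - s (l + k).+1).
Definition K2 (j : nat) : 'M[C]_(j.+1 * q) :=
  bmx j.+1 j.+1 (fun l k => - a *: s (l + k) + s (l + k).+1).

Definition u1 (j : nat) : 'M[C]_(j.+1 * q, q) :=
  bcol j.+1 (fun l => if l == 0%N then 0 else - s l.-1).
Definition u20 : M := - (a + b) *: s 0 + s 1.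
Definition u2 (j : nat) : 'M[C]_(j.+1 * q, q) :=
  bcol j.+1 (fun l => if l == 0%N then u20 else - shat l.-1).
Definition ut1 (j : nat) : 'M[C]_(j.+1 * q, q) :=
  bcol j.+1 (fun l => if l == 0%N then s 0 else s l - b *: s l.-1).

Definition Y1 (j : nat) : 'M[C]_(j * q, q) := bcol j (fun l => s (j + l)).
Definition Y2 (j : nat) : 'M[C]_(j * q, q) := bcol j (fun l => shat (j + l)).
Definition Yt1 (j : nat) : 'M[C]_(j * q, q) :=
  bcol j (fun l => b *: s (j + l) - s (j + l).+1).

Definition P2 (j : nat) (z : C) : M :=
  match j with
  | 0 => 1%:M
  | j'.+1 => browYH (Y2 j'.+1) (H2 j') *m Rmx j'.+1 z *m vmx j'.+1
  end.
Definition Q2 (j : nat) (z : C) : M :=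
  match j with
  | 0 => - (u20 + z *: s 0)
  | j'.+1 => - (browYH (Y2 j'.+1) (H2 j') *m Rmx j'.+1 z
                 *m (u2 j'.+1 + z *: (vmx j'.+1 *m s 0)))
  end.
Definition Gamma1 (j : nat) (z : C) : M :=
  match j with
  | 0 => 1%:M
  | j'.+1 => browYH (Yt1 j'.+1) (K1 j') *m Rmx j'.+1 z *m vmx j'.+1
  end.
Definition Theta1 (j : nat) (z : C) : M :=
  match j with
  | 0 => s 0
  | j'.+1 => browYH (Yt1 j'.+1) (K1 j') *m Rmx j'.+1 z *m ut1 j'.+1
  end.
(* P_{1,j}, Q_{1,j} are only defined for j >= 1; the value at j = 0 is a
   dummy that is never used. *)
Definition P1 (j : nat) (z : C) : M :=
  match j with
  | 0 => 0
  | j'.+1 => browYH (Y1 j'.+1) (H1 j') *m Rmx j'.+1 z *m vmx j'.+1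
  end.
Definition Q1 (j : nat) (z : C) : M :=
  match j with
  | 0 => 0
  | j'.+1 => - (browYH (Y1 j'.+1) (H1 j') *m Rmx j'.+1 z *m u1 j'.+1)
  end.

Definition lambda (j : nat) : M :=
  adj (u2 j + a *: (vmx j *m s 0)) *m adj (Rmx j a) *m invmx (H2 j)
    *m Rmx j a *m (u2 j + a *: (vmx j *m s 0)).
Definition mu (j : nat) : M :=
  adj (vmx j) *m adj (Rmx j a) *m invmx (K1 j) *m Rmx j a *m vmx j.

(* lb k = bold-l_{k-1}  (k >= 0), i.e. lb 0 = s_0, lb 1 = lambda_0,
   lb k = lambda_{k-1} - lambda_{k-2} for k >= 2 *)
Definition lb (k : nat) : M :=
  match k with
  | 0 => s 0
  | 1 => lambda 0
  | k'.+2 => lambda k'.+1 - lambda k'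
  end.
Definition mb (k : nat) : M :=
  match k with
  | 0 => mu 0
  | k'.+1 => mu k'.+1 - mu k'
  end.

Definition U (n : nat) (z : C) : 'M[C]_(q + q) :=
  block_mx
    (adj (Q2 n (Num.conj z)) *m invmx (adj (Q2 n a)))
    (- (adj (Q1 n.+1 (Num.conj z)) *m invmx (adj (P1 n.+1 a))))
    (- ((z - a) * (b - z)) *: (adj (P2 n (Num.conj z)) *m invmx (adj (Q2 n a))))
    (adj (P1 n.+1 (Num.conj z)) *m invmx (adj (P1 n.+1 a))).

End Defs.

Definition oprod (R : pzRingType) (p : nat) (m : nat) (A : nat -> 'M[R]_p) : 'M[R]_p :=
  foldr (fun X Y => X *m Y) 1%:M [seq A k | k <- iota 0 m].

(* Main.v *)
(** Read the block rows of [P], [Q], [Gamma], [Theta] as coefficients of matrix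
    polynomials.  With [L] the functional [t^i |-> s i], [Gamma1 j], [P2 j] and
    [P1 n.+1] are the monic orthogonal polynomials for the weights [b - t],
    [(t - a)(b - t)] and [1], and [Theta1 j], [Q2 j], [Q1 n.+1] are the second
    kind polynomials [L((F(w) - F(t)) / (w - t))] of [- (b - t) Gamma1 j],
    [(t - a)(b - t) P2 j] and [P1 n.+1].  A monic [F] of degree [j + 1] that is
    orthogonal to [1, ..., t^(j-1)] for the weight [b - t] satisfies the
    Christoffel identity [F = F(a) Gamma_j(a)^-1 Gamma_j + (t - a) P2_j]; it
    gives the recurrences that drive the induction on the product, and the last
    factor when applied to [F = P1 n.+1].  Schur complements turn the increments
    of the kernels [lambda], [mu] into [l_j = - Q2_j(a)^* Gamma_(j+1)(a)^*-1] and
    [m_j = Gamma_j(a)^* Q2_j(a)^*-1]. *)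
Require Import Defs.
From HB Require Import structures.
From mathcomp Require Import all_boot all_order all_algebra.
From mathcomp Require Import zify ring.
Set Implicit Arguments. Unset Strict Implicit. Unset Printing Implicit Defensive.
Import Order.TTheory GRing.Theory Num.Theory.
Local Open Scope ring_scope.

(** * Adjoints, invertibility and products of unipotent block matrices *)

Section Adjoint.
Variable C : numClosedFieldType.

Lemma adjmxK m p (A : 'M[C]_(m, p)) : adj (adj A) = A.
Proof. by apply/matrixP=> i k; rewrite !mxE conjCK. Qed.

Lemma adjmxD m p (A B : 'M[C]_(m, p)) : adj (A + B) = adj A + adj B.
Proof. by apply/matrixP=> i k; rewrite !mxE rmorphD. Qed.

Lemma adjmxN m p (A : 'M[C]_(m, p)) : adj (- A) = - adj A.
Proof. by apply/matrixP=> i k; rewrite !mxE rmorphN. Qed.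

Lemma adjmxB m p (A B : 'M[C]_(m, p)) : adj (A - B) = adj A - adj B.
Proof. by rewrite adjmxD adjmxN. Qed.

Lemma adjmxZ m p (c : C) (A : 'M[C]_(m, p)) : adj (c *: A) = Num.conj c *: adj A.
Proof. by apply/matrixP=> i k; rewrite !mxE rmorphM. Qed.

Lemma adjmxM m p r (A : 'M[C]_(m, p)) (B : 'M[C]_(p, r)) :
  adj (A *m B) = adj B *m adj A.
Proof. by rewrite /adj map_mxM trmx_mul. Qed.

Lemma adjmx0 m p : adj (0 : 'M[C]_(m, p)) = 0.
Proof. by rewrite /adj map_mx0 trmx0. Qed.

Lemma adjmx1 m : adj (1%:M : 'M[C]_m) = 1%:M.
Proof. by rewrite /adj map_mx1 trmx1. Qed.

Lemma adjmx_sum m p n (F : 'I_n -> 'M[C]_(m, p)) :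
  adj (\sum_i F i) = \sum_i adj (F i).
Proof. by apply: (big_morph _ (@adjmxD m p) (@adjmx0 m p)). Qed.

Lemma adj_invmx m (A : 'M[C]_m) : adj (invmx A) = invmx (adj A).
Proof. by rewrite /adj map_invmx trmx_inv. Qed.

Lemma adj_unitmx m (A : 'M[C]_m) : (adj A \in unitmx) = (A \in unitmx).
Proof. by rewrite /adj unitmx_tr map_unitmx. Qed.

(** [kermx A] is a square left annihilator of [A], so testing against square [y] is enough. *)
Lemma left_regular_unitmx m (A : 'M[C]_m) :
  (forall y : 'M[C]_m, y *m A = 0 -> y = 0) -> A \in unitmx.
Proof.
move=> regA; rewrite -row_free_unit -kermx_eq0; apply/eqP/regA.
exact: mulmx_ker.
Qed.

(** The transpose of a nonzero row of [kermx A^T] would be a nonzero vector killed by [A], against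
    positivity. *)
Lemma posdef_unitmx m (A : 'M[C]_m) : posdef A -> A \in unitmx.
Proof.
case=> _ Apos; rewrite -unitmx_tr -row_free_unit -kermx_eq0.
apply/eqP/row_matrixP=> i; rewrite row0; apply/eqP/negPn/negP=> ri0.
have x0 : (row i (kermx A^T))^T != 0 by rewrite -trmx0 (inj_eq trmx_inj).
have := Apos _ x0; rewrite -mulmxA -[X in _ *m (X *m _)]trmxK -trmx_mul.
by rewrite -row_mul mulmx_ker row0 trmx0 mulmx0 mxE ltxx.
Qed.

Lemma invmx_mul m (A B : 'M[C]_m) :
  A \in unitmx -> B \in unitmx -> invmx (A *m B) = invmx B *m invmx A.
Proof.
move=> Au Bu; have ABu : A *m B \in unitmx by rewrite unitmx_mul Au.
by rewrite -[RHS](mulmxK ABu) mulmxA mulmxKV // mulVmx // mul1mx.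
Qed.

Lemma invmx_opp m (A : 'M[C]_m) : A \in unitmx -> invmx (- A) = - invmx A.
Proof.
move=> Au; rewrite -!scaleN1r invmxZ ?unitrN1 ?invrN1 //.
by rewrite unitmxZ ?unitrN1.
Qed.

(** One factor of the product acts by column operations: [l] updates the right column, then [e]
    updates the left column with the new right one. *)
Lemma block_unipotent_step m (A B A' B' l e : 'M[C]_m) :
  block_mx A B A' B' *m (block_mx 1%:M l 0 1%:M *m block_mx 1%:M 0 e 1%:M)
  = block_mx (A + (A *m l + B) *m e) (A *m l + B)
             (A' + (A' *m l + B') *m e) (A' *m l + B').
Proof.
rewrite mulmxA !mulmx_block !mulmx1 !mulmx0 !addr0 !add0r.
by [].
Qed.

Lemma oprodS (p m : nat) (A : nat -> 'M[C]_p) : oprod m.+1 A = oprod m A *m A m.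
Proof.
rewrite /oprod -addn1 iotaD map_cat foldr_cat /= mulmx1 add0n.
by elim: (map _ _) => /= [|B t ->]; rewrite ?mul1mx ?mulmxA.
Qed.

Lemma conj_sub (z w x : C) :
  Num.conj w = z -> x \is Num.real -> Num.conj (w - x) = z - x.
Proof. by move=> wz xr; rewrite rmorphB /= wz (CrealP xr). Qed.

End Adjoint.

(** * Block columns and block matrices with [q x q] blocks *)

Section Blocks.
Variables (C : numClosedFieldType) (q : nat).
Local Notation M := 'M[C]_q.
Implicit Types (f g w x : nat -> M) (h : nat -> M).

Lemma sum_divmod (V : nmodType) m (F : nat -> nat -> V) :
  \sum_(i < m * q) F (i %/ q)%N (i %% q)%N = \sum_(l < m) \sum_(r < q) F l r.
Proof.
elim: m => [|m IHm]; first by rewrite !big_ord0.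
rewrite big_ord_recr /= -IHm -!(big_mkord xpredT (fun i => F (i %/ q)%N (i %% q)%N)).
rewrite mulSnr (@big_cat_nat _ _ _ (m * q)) ?leq_addr //=; congr (_ + _).
rewrite -{1}[(m * q)%N]add0n big_addn addKn big_mkord.
apply: eq_bigr => r _; have q0 : (0 < q)%N by apply: leq_ltn_trans (ltn_ord r).
by rewrite addnC divnMDl // modnMDl divn_small // addn0 modn_small.
Qed.

Lemma bentryE (B : M) (r c : 'I_q) : bentry B r c = B r c.
Proof. by rewrite /bentry !valK. Qed.

Lemma bentry_mulr p (A : M) (B : 'M[C]_(q, p)) r k (rq : (r < q)%N) :
  \sum_(t < q) bentry A r t * B t k = (A *m B) (Ordinal rq) k.
Proof.
by rewrite mxE; apply: eq_bigr => t _; rewrite -(bentryE A (Ordinal rq) t).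
Qed.

Lemma modq_ltn m (i : 'I_(m * q)) : (i %% q < q)%N.
Proof. by rewrite ltn_mod; case: q i => // -[i]; rewrite muln0. Qed.

Lemma divq_ltn m (i : 'I_(m * q)) : (i %/ q < m)%N.
Proof. by rewrite ltn_divLR ?ltn_ord //; apply: leq_ltn_trans (modq_ltn i). Qed.

Lemma bcolE m f (i : 'I_(m * q)) k :
  bcol m f i k = f (i %/ q)%N (Ordinal (modq_ltn i)) k.
Proof. by rewrite mxE -bentryE. Qed.

Lemma bmxE m p (B : nat -> nat -> M) (i : 'I_(m * q)) (k : 'I_(p * q)) :
  bmx m p B i k
  = B (i %/ q)%N (k %/ q)%N (Ordinal (modq_ltn i)) (Ordinal (modq_ltn k)).
Proof. by rewrite mxE -bentryE. Qed.

(** A total inverse of [bcol]: [insub] gives zero past the last row. *)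
Definition ublk m (A : 'M[C]_(m * q, q)) (l : nat) : M :=
  \matrix_(r, c) if insub (l * q + r)%N is Some i then A i c else 0.

Lemma bcol_ublk m (A : 'M[C]_(m * q, q)) : bcol m (ublk A) = A.
Proof.
by apply/matrixP=> i k; rewrite bcolE mxE /= -divn_eq valK.
Qed.

Lemma ublk_bcol m f l : (l < m)%N -> ublk (bcol m f) l = f l.
Proof.
move=> lm; apply/matrixP=> r c; rewrite mxE.
have q0 : (0 < q)%N by apply: leq_ltn_trans (ltn_ord r).
case: insubP => [i _ iE | /negP[]]; last first.
  by rewrite -ltn_divLR // divnMDl // divn_small // addn0.
have iq : (i %/ q = l)%N by rewrite iE divnMDl // divn_small // addn0.
rewrite bcolE iq; congr (f l _ _); apply/val_inj => /=.
by rewrite iE modnMDl modn_small.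
Qed.

Lemma eq_bcol m f g : (forall l, (l < m)%N -> f l = g l) -> bcol m f = bcol m g.
Proof. by move=> fg; apply/matrixP=> i k; rewrite !bcolE fg ?divq_ltn. Qed.

Lemma bcol_inj m f g :
  bcol m f = bcol m g -> forall l, (l < m)%N -> f l = g l.
Proof. by move=> fg l lm; rewrite -(ublk_bcol f lm) fg ublk_bcol. Qed.

Lemma bcolD m f g : bcol m f + bcol m g = bcol m (fun l => f l + g l).
Proof. by apply/matrixP=> i k; rewrite mxE !bcolE mxE. Qed.

Lemma bcol0 m : bcol m (fun=> 0 : M) = 0.
Proof. by apply/matrixP=> i k; rewrite bcolE !mxE. Qed.

Lemma bcolMr m f (A : M) : bcol m f *m A = bcol m (fun l => f l *m A).
Proof.
by apply/matrixP=> i k; rewrite bcolE !mxE; apply: eq_bigr => t _; rewrite bcolE.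
Qed.

Lemma bcolZ m f (c : C) : c *: bcol m f = bcol m (fun l => c *: f l).
Proof. by apply/matrixP=> i k; rewrite mxE !bcolE mxE. Qed.

Lemma bmx_mul_bcol m p (B : nat -> nat -> M) f :
  bmx m p B *m bcol p f = bcol m (fun l => \sum_(t < p) B l t *m f t).
Proof.
apply/matrixP=> i k; rewrite bcolE mxE summxE.
under eq_bigr do rewrite !mxE.
rewrite (sum_divmod p (fun l r => bentry (B (i %/ q)%N l) (i %% q) r * bentry (f l) r k)).
apply: eq_bigr => l _; rewrite -bentry_mulr.
by apply: eq_bigr => r _; rewrite !bentryE.
Qed.

Lemma adj_bcol_mul m f g :
  adj (bcol m f) *m bcol m g = \sum_(l < m) adj (f l) *m g l.
Proof.
apply/matrixP=> i k; rewrite mxE summxE.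
under eq_bigr do rewrite !mxE.
rewrite (sum_divmod m (fun l r => Num.conj (bentry (f l) r i) * bentry (g l) r k)).
apply: eq_bigr => l _; rewrite mxE.
by apply: eq_bigr => r _; rewrite !bentryE !mxE.
Qed.

Lemma adj_bmx m p (B : nat -> nat -> M) :
  adj (bmx m p B) = bmx p m (fun l k => adj (B k l)).
Proof. by apply/matrixP=> i k; rewrite bmxE !mxE -bentryE. Qed.

Lemma eq_bmx m p (B B' : nat -> nat -> M) :
  (forall l k, (l < m)%N -> (k < p)%N -> B l k = B' l k) -> bmx m p B = bmx m p B'.
Proof. by move=> BB; apply/matrixP=> i k; rewrite !bmxE BB ?divq_ltn. Qed.

(** A leading block is the compression by the coordinate inclusion [W], an isometry, so it inherits
    positive definiteness. *)
Lemma posdef_bmx_unit n m (B : nat -> nat -> M) :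
  (m <= n)%N -> posdef (bmx n n B) -> bmx m m B \in unitmx.
Proof.
move=> mn Bpos; apply: posdef_unitmx.
pose W : 'M[C]_(n * q, m * q) := \matrix_(i, k) (i == k :> nat)%:R.
have mnq : (m * q <= n * q)%N by rewrite leq_mul2r mn orbT.
have WE p (A : 'M[C]_(p, n * q)) i k : (A *m W) i k = A i (widen_ord mnq k).
  rewrite mxE (bigD1 (widen_ord mnq k)) //= mxE eqxx mulr1 big1 ?addr0 // => t.
  by rewrite mxE -val_eqE /= => /negbTE->; rewrite mulr0.
have adjWE p (A : 'M[C]_(n * q, p)) i k : (adj W *m A) i k = A (widen_ord mnq i) k.
  rewrite mxE (bigD1 (widen_ord mnq i)) //= !mxE eqxx conjC1 mul1r.
  rewrite big1 ?addr0 // => t.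
  by rewrite !mxE -val_eqE /= => /negbTE->; rewrite conjC0 mul0r.
have -> : bmx m m B = adj W *m bmx n n B *m W.
  by apply/matrixP=> i k; rewrite WE adjWE !mxE.
case: Bpos => Bherm Bpos; split; first by rewrite !adjmxM adjmxK Bherm mulmxA.
move=> x x0; rewrite !mulmxA -adjmxM -mulmxA; apply: Bpos.
apply/eqP=> Wx; case/eqP: x0.
have WW : adj W *m W = 1%:M.
  by apply/matrixP=> i k; rewrite WE !mxE conjC_nat /= eq_sym.
by rewrite -[x]mul1mx -WW -mulmxA Wx mulmx0.
Qed.

End Blocks.

(** * Matrix polynomials as coefficient sequences, and Hankel orthogonality *)

Section OrthogonalPolynomials.
Variables (C : numClosedFieldType) (q : nat).
Local Notation M := 'M[C]_q.
Implicit Types (f g w p r h : nat -> M).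

(** Horner form of the sum of [z ^+ (k - i) *: f i] over [i <= k], which is block [k] of the
    resolvent applied to [f]. *)
Fixpoint conv (z : C) f (k : nat) : M :=
  if k is k'.+1 then z *: conv z f k' + f k else f 0%N.

Lemma Tmx_mul_bcol j f :
  Tmx C q j *m bcol j.+1 f = bcol j.+1 (fun l => if l is l'.+1 then f l' else 0).
Proof.
rewrite bmx_mul_bcol; apply: eq_bcol => -[|l] lj.
  by rewrite big1 // => t _; rewrite mul0mx.
rewrite (bigD1 (Ordinal (ltnW lj))) //= eqxx mul1mx big1 ?addr0 // => t.
by rewrite -val_eqE /= eq_sym eqSS => /negbTE->; rewrite mul0mx.
Qed.

Lemma one_sub_Tmx_mul_bcol j z f :
  (1%:M - z *: Tmx C q j) *m bcol j.+1 (conv z f) = bcol j.+1 f.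
Proof.
rewrite mulmxBl mul1mx -scalemxAl Tmx_mul_bcol bcolZ.
apply/(canLR (addrK _)); rewrite bcolD; apply: eq_bcol => -[|l] _ /=.
  by rewrite scaler0 addr0.
by rewrite addrC.
Qed.

(** Every block column is in the range of [1 - z T] by the previous lemma, so a left annihilator of
    [1 - z T] kills all block columns. *)
Lemma one_sub_Tmx_unit j z : 1%:M - z *: Tmx C q j \in unitmx.
Proof.
apply: left_regular_unitmx => y yT0; apply/matrixP=> i k.
have yA0 (A : 'M[C]_(j.+1 * q, q)) : y *m A = 0.
  by rewrite -[A]bcol_ublk -(one_sub_Tmx_mul_bcol j z) mulmxA yT0 mul0mx.
(* Any column index would do; [modq_ltn k] supplies an element of ['I_q]. *)
have /matrixP/(_ i (Ordinal (modq_ltn k))) := yA0 (delta_mx k (Ordinal (modq_ltn k))).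
rewrite !mxE (bigD1 k) //= mxE !eqxx mulr1 big1 ?addr0 // => t /negbTE tk.
by rewrite mxE tk mulr0.
Qed.

Lemma Rmx_mul_bcol j z f : Rmx q j z *m bcol j.+1 f = bcol j.+1 (conv z f).
Proof.
by rewrite -(one_sub_Tmx_mul_bcol j z) mulKmx // one_sub_Tmx_unit.
Qed.

Lemma bcolS j f (e : (j * q + q)%N = (j.+1 * q)%N) :
  bcol j.+1 f = castmx (e, erefl q) (col_mx (bcol j f) (f j)).
Proof.
apply/matrixP=> i k; rewrite castmxE cast_ord_id -[i](cast_ordKV e).
case: (split_ordP (cast_ord (esym e) i)) => t ->; rewrite cast_ordK.
  by rewrite col_mxEu !mxE.
rewrite col_mxEd mxE /=.
have q0 : (0 < q)%N by apply: leq_ltn_trans (ltn_ord t).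
by rewrite divnMDl // modnMDl divn_small // addn0 modn_small // bentryE.
Qed.

Lemma mulmx_castmx (m n n' k : nat) (e : n = n') (A : 'M[C]_(m, n)) (B : 'M[C]_(n, k)) :
  castmx (erefl m, e) A *m castmx (e, erefl k) B = A *m B.
Proof. by case: n' / e; rewrite !castmx_id. Qed.

Lemma browYH_mul_bcol j (Y : 'M[C]_(j * q, q)) (H : 'M[C]_(j * q)) f :
  browYH Y H *m bcol j.+1 f = - (adj Y *m invmx H) *m bcol j f + f j.
Proof.
by rewrite (bcolS _ (esym (mulSnr j q))) mulmx_castmx mul_row_col mul1mx.
Qed.

(** Here [j] counts block rows: [hankel s n.+1] is [H1 s n], and the empty [hankel h 0] lets
    inductions start without a special case. *)
Definition hankel h j : 'M[C]_(j * q) := bmx j j (fun l k => h (l + k)%N).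

Definition hermitian_below h N := forall i, (i < N)%N -> adj (h i) = h i.

Lemma adj_hankel h j : hermitian_below h j.*2.-1 -> adj (hankel h j) = hankel h j.
Proof.
move=> hh; rewrite adj_bmx; apply: eq_bmx => l k lj kj; rewrite addnC hh //; lia.
Qed.

Lemma hermitian_below_le h N N' :
  (N' <= N)%N -> hermitian_below h N -> hermitian_below h N'.
Proof. by move=> NN hh i iN; apply: hh; apply: leq_trans NN. Qed.

(* Pairing of the coefficients of a polynomial of degree at most d with a
   sequence: f i = z^i evaluates at z, while f i = h (i + k) gives the k-th
   moment of the polynomial with respect to the functional t^i |-> h i. *)
Definition pairing d p f : M := \sum_(i < d.+1) p i *m f i.

Definition powers (z : C) i : M := (z ^+ i)%:M.

Definition degree_le d p := forall i, (d < i)%N -> p i = 0.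

Definition monic_orthogonal h j p :=
  [/\ p j = 1%:M, degree_le j p
    & forall k, (k < j)%N -> pairing j p (fun i => h (i + k)%N) = 0].

Lemma eq_pairing d p f g :
  (forall i, (i <= d)%N -> f i = g i) -> pairing d p f = pairing d p g.
Proof. by move=> fg; rewrite /pairing; apply: eq_bigr => i _; rewrite fg // -ltnS. Qed.

Lemma pairing_addn0 d p h : pairing d p (fun i => h (i + 0)%N) = pairing d p h.
Proof. by apply: eq_pairing => i _; rewrite addn0. Qed.

Lemma pairing_widen d e p f :
  degree_le d p -> (d <= e)%N -> pairing e p f = pairing d p f.
Proof.
move=> pd de; rewrite /pairing [RHS](big_ord_widen e.+1 (fun i => p i *m f i)) //.
rewrite [RHS]big_mkcond; apply: eq_bigr => i _; case: ltnP => // di.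
by rewrite pd ?mul0mx.
Qed.

Lemma pairingD d p f g :
  pairing d p (fun i => f i + g i) = pairing d p f + pairing d p g.
Proof. by rewrite /pairing -big_split; apply: eq_bigr => i _; rewrite mulmxDr. Qed.

Lemma pairingZ d p c f : pairing d p (fun i => c *: f i) = c *: pairing d p f.
Proof. by rewrite /pairing scaler_sumr; apply: eq_bigr => i _; rewrite scalemxAr. Qed.

Lemma pairingB d p f g :
  pairing d p (fun i => f i - g i) = pairing d p f - pairing d p g.
Proof.
rewrite pairingD -[X in _ = _ + X]scaleN1r -pairingZ; congr (_ + _).
by apply: eq_pairing => i _; rewrite scaleN1r.
Qed.

Lemma pairingDl d p r f :
  pairing d (fun i => p i + r i) f = pairing d p f + pairing d r f.
Proof. by rewrite /pairing -big_split; apply: eq_bigr => i _; rewrite mulmxDl. Qed.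

Lemma pairingMl d A p f : pairing d (fun i => A *m p i) f = A *m pairing d p f.
Proof. by rewrite /pairing mulmx_sumr; apply: eq_bigr => i _; rewrite mulmxA. Qed.

Lemma pairingZl d c p f : pairing d (fun i => c *: p i) f = c *: pairing d p f.
Proof. by rewrite /pairing scaler_sumr; apply: eq_bigr => i _; rewrite scalemxAl. Qed.

Lemma pairingNl d p f : pairing d (fun i => - p i) f = - pairing d p f.
Proof. by rewrite /pairing -sumrN; apply: eq_bigr => i _; rewrite mulNmx. Qed.

Lemma pairingBl d p r f :
  pairing d (fun i => p i - r i) f = pairing d p f - pairing d r f.
Proof. by rewrite pairingDl pairingNl. Qed.

Definition shiftp p i : M := if i is i'.+1 then p i' else 0.

Lemma pairing_shiftp d p f :
  pairing d.+1 (shiftp p) f = pairing d p (fun i => f i.+1).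
Proof. by rewrite /pairing big_ord_recl mul0mx add0r. Qed.

(** Blocks of the row [(- Y^* H^-1, I)] for Hermitian [H], extended by zero; these are the
    coefficients of a monic polynomial of degree [j]. *)
Definition opol h j (i : nat) : M :=
  if (i < j)%N then
    - adj (ublk (invmx (hankel h j) *m bcol j (fun l => h (j + l)%N)) i)
  else if i == j then 1%:M else 0.

Lemma opol_diag h j : opol h j j = 1%:M.
Proof. by rewrite /opol ltnn eqxx. Qed.

Lemma pairing0 h f : pairing 0 (opol h 0) f = f 0%N.
Proof. by rewrite /pairing big_ord1 opol_diag mul1mx. Qed.

Section Hankel.
Variables (h : nat -> M) (j : nat).
Hypothesis Hunit : hankel h j \in unitmx.

(** The hypotheses say that [hankel h j] kills the column of adjoint coefficients. All uniqueness
    arguments below rest on this. *)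
Lemma hankel_nondegenerate p :
    hermitian_below h j.*2.-1 -> (forall i, (j <= i)%N -> p i = 0) ->
    (forall k, (k < j)%N -> \sum_(i < j) p i *m h (i + k)%N = 0) ->
  forall i, p i = 0.
Proof.
move=> hh pj p0.
have: bcol j (fun i => adj (p i)) = 0.
  rewrite -[LHS](mulKmx Hunit) -[X in invmx X *m (X *m _)](adj_hankel hh).
  rewrite adj_hankel // bmx_mul_bcol -(mulmx0 _ (invmx (hankel h j))).
  congr (_ *m _); rewrite -[RHS](bcol0 C q); apply: eq_bcol => k kj.
  transitivity (adj (\sum_(i < j) p i *m h (i + k)%N)); last by rewrite p0 ?adjmx0.
  rewrite adjmx_sum.
  apply: eq_bigr => i _; rewrite adjmxM hh addnC //.
  by have := ltn_ord i; lia.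
rewrite -[X in _ = X](bcol0 C q) => /bcol_inj pi0 i.
by case: (ltnP i j) => [/pi0 /(canRL (@adjmxK _ _ _)) | /pj //]; rewrite adjmx0.
Qed.

Lemma browYH_opol f :
    adj (hankel h j) = hankel h j ->
  browYH (bcol j (fun l => h (j + l)%N)) (hankel h j) *m bcol j.+1 f
  = pairing j (opol h j) f.
Proof.
move=> Hh; rewrite browYH_mul_bcol /pairing big_ord_recr /= /opol ltnn eqxx.
rewrite mul1mx; congr (_ + _); rewrite -[in LHS]Hh -adj_invmx -adjmxM.
rewrite -[X in adj X]bcol_ublk mulNmx adj_bcol_mul -sumrN.
by apply: eq_bigr => i _; rewrite ltn_ord mulNmx.
Qed.

Lemma browYH_Rmx z f :
    adj (hankel h j) = hankel h j ->
  browYH (bcol j (fun l => h (j + l)%N)) (hankel h j) *m Rmx q j z *m bcol j.+1 f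
  = pairing j (opol h j) (conv z f).
Proof. by move=> Hh; rewrite -mulmxA Rmx_mul_bcol browYH_opol. Qed.

(** Up to adjoint and sign, orthogonality to [t^k] is block row [k] of the Hankel system that the
    lower coefficients solve. *)
Lemma opol_orthogonal :
  hermitian_below h j.*2 -> monic_orthogonal h j (opol h j).
Proof.
move=> hh; split=> [|i ji|k kj]; [exact: opol_diag | rewrite /opol ..].
  by rewrite ltnNge (ltnW ji) eq_sym (ltn_eqF ji).
rewrite /pairing big_ord_recr /= ltnn eqxx mul1mx.
set x := ublk _; have : hankel h j *m bcol j x = bcol j (fun l => h (j + l)%N).
  by rewrite bcol_ublk mulKVmx.
rewrite bmx_mul_bcol => /bcol_inj /(_ _ kj) xk.
apply/eqP; rewrite addr_eq0 -(hh (j + k)%N); last by rewrite -addnn ltn_add2l.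
rewrite -xk adjmx_sum -sumrN; apply/eqP/eq_bigr => i _.
by rewrite ltn_ord adjmxM mulNmx addnC hh // -addnn -addSn leq_add // ltnW.
Qed.

End Hankel.

(** * Gram forms, norms and reproducing kernels *)

Definition gram d e h p r : M :=
  \sum_(i < d.+1) \sum_(k < e.+1) p i *m h (i + k)%N *m adj (r k).

Lemma adj_gram d e h p r :
  hermitian_below h (d + e).+1 -> adj (gram d e h p r) = gram e d h r p.
Proof.
move=> hh; rewrite adjmx_sum [RHS]exchange_big; apply: eq_bigr => i _.
rewrite adjmx_sum; apply: eq_bigr => k _.
rewrite !adjmxM adjmxK mulmxA [X in h X]addnC hh //.
by have := ltn_ord i; have := ltn_ord k; lia.
Qed.

Lemma gram_pairing d e h p r :
  gram d e h p r
  = \sum_(k < e.+1) pairing d p (fun i => h (i + k)%N) *m adj (r k).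
Proof.
rewrite /gram exchange_big; apply: eq_bigr => k _.
by rewrite mulmx_suml.
Qed.

Lemma adj_pairing_powers d (z : C) p :
  z \is Num.real ->
  adj (pairing d p (powers z)) = \sum_(k < d.+1) z ^+ k *: adj (p k).
Proof.
move=> zr; rewrite adjmx_sum; apply: eq_bigr => k _.
by rewrite /powers mul_mx_scalar adjmxZ rmorphXn /= (CrealP zr).
Qed.

(* For monic orthogonal p this is the whole Gram matrix of p with itself. *)
Definition sqnorm h j p : M := pairing j p (fun i => h (i + j)%N).

Lemma gram_orthogonal h j p r :
  monic_orthogonal h j p -> gram j j h p r = sqnorm h j p *m adj (r j).
Proof.
case=> _ _ p0; rewrite gram_pairing big_ord_recr /= big1 ?add0r // => k _.
by rewrite p0 ?mul0mx.
Qed.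

Lemma adj_sqnorm h j p :
  hermitian_below h j.*2.+1 -> monic_orthogonal h j p ->
  adj (sqnorm h j p) = sqnorm h j p.
Proof.
move=> hh op; have := gram_orthogonal p op; have [pj _ _] := op.
by rewrite pj adjmx1 mulmx1 => <-; rewrite adj_gram // addnn.
Qed.

(** If [y] kills the norm, then [y p] is orthogonal to [t^j] as well, hence vanishes, and its
    leading coefficient is [y]. *)
Lemma sqnorm_unit h j p :
  hermitian_below h j.*2.+1 -> hankel h j.+1 \in unitmx ->
  monic_orthogonal h j p -> sqnorm h j p \in unitmx.
Proof.
move=> hh Hu [pj pd p0]; apply: left_regular_unitmx => y ys.
rewrite -[y]mulmx1 -pj.
apply: (hankel_nondegenerate Hu (p := fun i => y *m p i)) => [||k] //.
  by move=> i /pd ->; rewrite mulmx0.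
rewrite ltnS leq_eqVlt => /predU1P[-> | kj].
  by have := pairingMl j y p (fun i => h (i + j)%N); rewrite ys.
by have := pairingMl j y p (fun i => h (i + k)%N); rewrite p0 // mulmx0.
Qed.

(** Common shape of [mu] and [lambda]; for [w = powers q a] it is the Christoffel-Darboux kernel at
    [(a, a)]. *)
Definition kernel h j w : M :=
  adj (bcol j w) *m invmx (hankel h j) *m bcol j w.

Lemma kernel0 h w : kernel h 0 w = 0.
Proof. by apply/matrixP=> i k; rewrite !mxE big1 // => -[]. Qed.

Lemma adj_kernel h j w :
  hermitian_below h j.*2.-1 -> adj (kernel h j w) = kernel h j w.
Proof. by move=> hh; rewrite !adjmxM adjmxK adj_invmx adj_hankel // mulmxA. Qed.

(* Schur complement: with x' the solution of the truncated Hankel system, the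
   full system is solved by x' + p^* d, where d = sqnorm^-1 <p, w>. *)
Lemma kernelS h j p w :
    hermitian_below h j.*2.+1 -> hankel h j \in unitmx ->
    hankel h j.+1 \in unitmx -> monic_orthogonal h j p ->
  kernel h j.+1 w
  = kernel h j w
    + adj (pairing j p w) *m invmx (sqnorm h j p) *m pairing j p w.
Proof.
move=> hh Hu HuS op; have [pj pd p0] := op.
have su := sqnorm_unit hh HuS op; have sh := adj_sqnorm hh op.
pose x' := ublk (invmx (hankel h j) *m bcol j w).
have Hx' l : (l < j)%N -> \sum_(k < j) h (l + k)%N *m x' k = w l.
  move=> lj; have : hankel h j *m bcol j x' = bcol j w.
    by rewrite bcol_ublk mulKVmx.
  by rewrite bmx_mul_bcol => /bcol_inj /(_ _ lj).
pose d := invmx (sqnorm h j p) *m pairing j p w.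
have Hp l : (l <= j)%N ->
    \sum_(k < j.+1) h (l + k)%N *m adj (p k) = adj (pairing j p (fun i => h (i + l)%N)).
  move=> lj; rewrite adjmx_sum; apply: eq_bigr => k _.
  rewrite adjmxM [X in h X]addnC hh //.
  by have := ltn_ord k; lia.
pose x k := (if (k < j)%N then x' k else 0) + adj (p k) *m d.
have sumx (A : nat -> M) : \sum_(k < j.+1) A k *m x k
    = \sum_(k < j) A k *m x' k + (\sum_(k < j.+1) A k *m adj (p k)) *m d.
  under eq_bigr do rewrite mulmxDr mulmxA.
  rewrite big_split /= -mulmx_suml big_ord_recr /= ltnn mulmx0 addr0.
  by congr (_ + _); apply: eq_bigr => k _; rewrite ltn_ord.
have Hx : hankel h j.+1 *m bcol j.+1 x = bcol j.+1 w.
  rewrite bmx_mul_bcol; apply: eq_bcol => l; rewrite ltnS => lj.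
  rewrite (sumx (fun k => h (l + k)%N)) Hp //.
  move: lj; rewrite leq_eqVlt => /predU1P[-> | lj]; last first.
    by rewrite p0 // adjmx0 mul0mx addr0 Hx'.
  rewrite -/(sqnorm h j p) sh /d mulKVmx // {1}/pairing big_ord_recr /= pj mul1mx.
  rewrite addrA -[RHS]add0r; congr (_ + _).
  (* In the last block row, expressing [w k] through [x'] turns the remaining terms into the
     orthogonality relations of [p]. *)
  under [X in _ + X]eq_bigr => k _ do rewrite -Hx' // mulmx_sumr.
  rewrite exchange_big /= -big_split big1 // => k _ /=.
  under eq_bigr do rewrite mulmxA.
  rewrite -mulmx_suml -mulmxDl.
  have /= := p0 k (ltn_ord k); rewrite /pairing big_ord_recr /= pj mul1mx addrC.
  by move=> ->; rewrite mul0mx.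
rewrite /kernel -mulmxA -[X in _ *m (_ *m X)]Hx mulKmx // adj_bcol_mul.
rewrite (sumx (fun k => adj (w k))) -adj_bcol_mul bcol_ublk mulmxA /d mulmxA.
congr (_ + _ *m _ *m _); rewrite adjmx_sum.
by apply: eq_bigr => k _; rewrite adjmxM.
Qed.

End OrthogonalPolynomials.

#[local] Opaque opol.

(** * Relations between the orthogonal families of the three weights *)

Section Recurrences.
Variables (C : numClosedFieldType) (q : nat) (n : nat) (a b : C).
Variable s : nat -> 'M[C]_q.
Hypotheses (a_real : a \is Num.real) (b_real : b \is Num.real).
Hypothesis s_herm : hermitian_below s n.+1.*2.

(* Moments of (b - t) times the functional t^i |-> s i. *)
Definition sb (i : nat) : 'M[C]_q := b *: s i - s i.+1.

Local Notation sh := (shat a b s).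
Local Notation gam j := (opol sb j).
Local Notation p2 j := (opol sh j).
Local Notation p1 := (opol s n.+1).
Local Notation Ga j := (pairing j (gam j) (powers q a)).
Local Notation Q2a j := (pairing j (p2 j) sb).

Hypothesis sb_unit : forall j, (j <= n.+1)%N -> hankel sb j \in unitmx.
Hypothesis sh_unit : forall j, (j <= n)%N -> hankel sh j \in unitmx.

(** The weight [(t - a)(b - t)] is [t - a] times [b - t]; this transfers facts between the two
    families. *)
Lemma shat_sb i : sh i = sb i.+1 - a *: sb i.
Proof.
by apply/matrixP=> r c; rewrite /shat /sb !mxE; ring.
Qed.

Lemma sb_herm : hermitian_below sb n.*2.+1.
Proof.
move=> i i_lt; rewrite /sb adjmxB adjmxZ /= (CrealP b_real) !s_herm //; lia.
Qed.

Lemma sh_herm : hermitian_below sh n.*2.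
Proof.
move=> i i_lt; rewrite shat_sb adjmxB adjmxZ /= (CrealP a_real) !sb_herm //; lia.
Qed.

Lemma gam_orthogonal j : (j <= n)%N -> monic_orthogonal sb j (gam j).
Proof.
move=> jn; apply: opol_orthogonal; first by apply: sb_unit; lia.
by apply: hermitian_below_le sb_herm; lia.
Qed.

Lemma p2_orthogonal j : (j <= n)%N -> monic_orthogonal sh j (p2 j).
Proof.
move=> jn; apply: opol_orthogonal; first by apply: sh_unit; lia.
by apply: hermitian_below_le sh_herm; lia.
Qed.

Lemma orthogonal_eq0 j d p :
    (j <= n)%N -> (j <= d.+1)%N -> (forall i, (j <= i)%N -> p i = 0) ->
    (forall k, (k < j)%N -> pairing d p (fun i => sb (i + k)%N) = 0) ->
  forall i, p i = 0.
Proof.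
move=> jn jd pj p0; apply: (hankel_nondegenerate (j := j) _ _ pj).
- by apply: sb_unit; lia.
- by apply: hermitian_below_le sb_herm; lia.
move=> k kj; rewrite -[RHS](p0 k kj) /pairing.
rewrite (big_ord_widen d.+1 (fun i => p i *m sb (i + k)%N)) // big_mkcond.
apply: eq_bigr => i _; case: ltnP => // /pj ->.
by rewrite mul0mx.
Qed.

(** Orthogonality to [t^k] for [(t - a)(b - t)] says that moment [k + 1] of [p2 j] for [b - t] is
    [a] times moment [k]. *)
Lemma pairing_p2_sb j k :
  (j <= n)%N -> (k <= j)%N ->
  pairing j (p2 j) (fun i => sb (i + k)%N) = a ^+ k *: Q2a j.
Proof.
move=> jn; have [_ _ p0] := p2_orthogonal jn.
elim: k => [|k IHk] kj.
  by rewrite scale1r pairing_addn0.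
rewrite exprS -scalerA -IHk ?(ltnW kj) // -pairingZ.
rewrite -[RHS]add0r -(p0 k kj) -pairingD; apply: eq_pairing => i _.
by rewrite shat_sb addnS subrK.
Qed.

(** Up to the left factor [Q2a j], [p2 j] reproduces evaluation at [a] for the weight [b - t] in
    degree at most [j]. *)
Lemma gram_p2 j p :
  (j <= n)%N ->
  gram j j sb (p2 j) p = Q2a j *m adj (pairing j p (powers q a)).
Proof.
move=> jn; rewrite gram_pairing adj_pairing_powers // mulmx_sumr.
apply: eq_bigr => k _.
by rewrite pairing_p2_sb -1?ltnS // -scalemxAl scalemxAr.
Qed.

(** The Gram value of [gam j] and [p2 j] is computed twice: by orthogonality of [gam j], and by
    evaluation at [a]. *)
Lemma sqnorm_gam j : (j <= n)%N -> sqnorm sb j (gam j) = Ga j *m adj (Q2a j).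
Proof.
move=> jn; have [pj _ _] := p2_orthogonal jn.
rewrite -[LHS]mulmx1 -(adjmx1 C) -pj -gram_orthogonal; last exact: gam_orthogonal.
rewrite -adj_gram ?gram_p2 ?adjmxM ?adjmxK //.
by apply: hermitian_below_le sb_herm; lia.
Qed.

Lemma sqnorm_gam_unit j : (j <= n)%N -> sqnorm sb j (gam j) \in unitmx.
Proof.
move=> jn; apply: sqnorm_unit (gam_orthogonal jn); last by apply: sb_unit.
by apply: hermitian_below_le sb_herm; lia.
Qed.

Lemma Ga_unit j : (j <= n)%N -> Ga j \in unitmx.
Proof.
by move=> jn; have := sqnorm_gam_unit jn; rewrite sqnorm_gam // unitmx_mul => /andP[].
Qed.

Lemma Q2a_unit j : (j <= n)%N -> Q2a j \in unitmx.
Proof.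
move=> jn; have := sqnorm_gam_unit jn.
by rewrite sqnorm_gam // unitmx_mul adj_unitmx => /andP[].
Qed.

(** [p2 j] and [gam j.+1] are orthogonal for [b - t]. Expanding this, the terms up to degree [j]
    give evaluation at [a], and the top term exceeds it by exactly the norm of [p2 j]. *)
Lemma sqnorm_p2 j :
  (j < n)%N -> sqnorm sh j (p2 j) = - (Q2a j *m adj (Ga j.+1)).
Proof.
move=> jn; have jn' := ltnW jn.
have [g1 _ g0] := gam_orthogonal jn; have [_ p2d _] := p2_orthogonal jn'.
have gram0 : gram j j.+1 sb (p2 j) (gam j.+1) = 0.
  rewrite -adj_gram; last by apply: hermitian_below_le sb_herm; lia.
  rewrite gram_pairing big1 ?adjmx0 // => k _.
  by rewrite g0 ?mul0mx.
apply/eqP; rewrite -addr_eq0 addrC; apply/eqP.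
rewrite -[RHS]gram0 gram_pairing adj_pairing_powers // mulmx_sumr.
rewrite big_ord_recr [in RHS]big_ord_recr /= -addrA; congr (_ + _).
  apply: eq_bigr => k _.
  by rewrite pairing_p2_sb -1?ltnS // -scalemxAl scalemxAr.
rewrite g1 adjmx1 -scalemxAr !mulmx1 exprS -scalerA -pairing_p2_sb //.
rewrite -pairingZ -pairingD; apply: eq_pairing => i _.
by rewrite shat_sb addnS addrC subrK.
Qed.

(** The difference [D] of the two sides has degree at most [j] and is orthogonal to lower powers, so
    it is [D j] times [gam j]; it vanishes at [a], where [gam j] is invertible. Pairing with an
    arbitrary [f] covers values and second kind polynomials at once. *)
Lemma christoffel j F f :
    (j <= n)%N -> F j.+1 = 1%:M -> degree_le j.+1 F ->
    (forall k, (k < j)%N -> pairing j.+1 F (fun i => sb (i + k)%N) = 0) ->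
  pairing j.+1 F f
  = pairing j.+1 F (powers q a) *m invmx (Ga j) *m pairing j (gam j) f
    + pairing j (p2 j) (fun i => f i.+1 - a *: f i).
Proof.
move=> jn F1 Fd F0; set c := _ *m invmx (Ga j).
have [g1 gd g0] := gam_orthogonal jn; have [p1j pd _] := p2_orthogonal jn.
pose D i := F i - c *m gam j i - (shiftp (p2 j) i - a *: p2 j i).
have DE f' : pairing j.+1 D f' = pairing j.+1 F f' - c *m pairing j (gam j) f'
    - pairing j (p2 j) (fun i => f' i.+1 - a *: f' i).
  rewrite !pairingBl pairingMl pairingZl pairing_shiftp pairingB pairingZ.
  by rewrite !(pairing_widen _ gd (leqnSn j)) !(pairing_widen _ pd (leqnSn j)).
have D0 k : (k < j)%N -> pairing j.+1 D (fun i => sb (i + k)%N) = 0.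
  move=> kj; rewrite DE (F0 _ kj) (g0 _ kj) mulmx0 subr0 sub0r.
  have [_ _ p20] := p2_orthogonal jn; rewrite -oppr0 -(p20 k kj); congr (- _).
  by apply: eq_pairing => i _; rewrite shat_sb.
have Da : pairing j.+1 D (powers q a) = 0.
  rewrite DE mulmxKV ?Ga_unit // subrr sub0r.
  rewrite [pairing _ _ _]big1 ?oppr0 // => i _.
  by rewrite /powers exprS -scale_scalar_mx subrr mulmx0.
have Dd i : (j < i)%N -> D i = 0.
  rewrite /D => ji; rewrite gd // mulmx0 subr0 (pd i) // scaler0 subr0.
  case: i ji => // i; rewrite ltnS leq_eqVlt => /predU1P[<- | ji] /=.
    by rewrite p1j F1 subrr.
  by rewrite Fd // pd // subr0.
have DgE f' : pairing j.+1 D f' = D j *m pairing j (gam j) f'.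
  apply/eqP; rewrite -subr_eq0 -pairingMl.
  rewrite -(pairing_widen (d := j) (e := j.+1)) => [|i ji|] //; last first.
    by rewrite gd // mulmx0.
  rewrite -pairingBl [pairing _ _ _]big1 // => i _.
  rewrite (@orthogonal_eq0 j j.+1 (fun i => D i - D j *m gam j i)) ?mul0mx ?leqW //.
  - by move=> {}i; rewrite leq_eqVlt => /predU1P[<- | ji];
       rewrite ?g1 ?mulmx1 ?subrr // Dd // gd // mulmx0 subrr.
  by move=> k kj; rewrite pairingBl D0 // pairingMl (pairing_widen _ gd) // g0 // mulmx0 subrr.
have Dj : D j = 0.
  have := DgE (powers q a); rewrite Da => /(congr1 (fun A => A *m invmx (Ga j))).
  by rewrite mul0mx mulmxK ?Ga_unit.
have := DE f; rewrite DgE Dj mul0mx => /eqP.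
by rewrite eq_sym subr_eq0 subr_eq addrC => /eqP.
Qed.

(** For [b - t], the moments of [p2 j.+1] and [p2 j] up to order [j] are proportional to powers of
    [a]; the factor [c] makes them cancel, and uniqueness applies in degree [j]. *)
Lemma pairing_p2S j f :
  (j < n)%N ->
  pairing j.+1 (p2 j.+1) f
  = pairing j.+1 (gam j.+1) f
    + Q2a j.+1 *m invmx (Q2a j) *m pairing j (p2 j) f.
Proof.
move=> jn; have jn' := ltnW jn; set c := _ *m invmx _.
have [g1 gd g0] := gam_orthogonal jn; have [p1j pd _] := p2_orthogonal jn.
have [_ pd' _] := p2_orthogonal jn'.
pose D i := p2 j.+1 i - c *m p2 j i - gam j.+1 i.
have D0 : forall i, D i = 0.
  apply: (@orthogonal_eq0 j.+1 j.+1) => // [i|k kj].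
    rewrite /D leq_eqVlt => /predU1P[<- | ji].
      by rewrite p1j g1 pd' // mulmx0 subr0 subrr.
    by rewrite pd // gd // pd' ?mulmx0 ?subr0 // ltnW.
  rewrite !pairingBl (g0 _ kj) subr0 pairingMl (pairing_widen _ pd' (leqnSn j)).
  rewrite !pairing_p2_sb ?(ltnW kj) // -scalemxAr mulmxKV ?subrr //.
  exact: Q2a_unit.
have : pairing j.+1 D f = 0 by rewrite [LHS]big1 // => i _; rewrite D0 mul0mx.
rewrite !pairingBl pairingMl (pairing_widen _ pd' (leqnSn j)) => /eqP.
by rewrite !subr_eq add0r => /eqP.
Qed.

Implicit Types w : C.

(* theta w i is minus the second kind polynomial of (b - t) t^i at w, qseq w i
   that of (t - a)(b - t) t^i, and zc w k i that of t^i for the shifted moments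
   s (_ + k). *)
Fixpoint theta (w : C) (i : nat) : 'M[C]_q :=
  if i is i'.+1 then w *: theta w i' - sb i' else s 0.

Definition qseq (w : C) i : 'M[C]_q := sb i - (w - a) *: theta w i.

Fixpoint zc (w : C) (k i : nat) : 'M[C]_q :=
  if i is i'.+1 then w *: zc w k i' + s (i' + k)%N else 0.

Local Notation Gv w j := (pairing j (gam j) (powers q w)).
Local Notation Tv w j := (pairing j (gam j) (theta w)).
Local Notation Pv w j := (pairing j (p2 j) (powers q w)).
Local Notation Qv w j := (pairing j (p2 j) (qseq w)).

(** * The resolvent formulas rewritten as pairings *)

Lemma conv_vmx w i :
  conv w (fun l => if l == 0%N then 1%:M : 'M[C]_q else 0) i = powers q w i.
Proof.
by elim: i => //= i ->; rewrite addr0 /powers exprS scale_scalar_mx.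
Qed.

Lemma conv_ut1 w i :
  conv w (fun l : nat => if l == 0%N then s 0 else s l - b *: s l.-1) i = theta w i.
Proof. by elim: i => //= i ->; rewrite /sb opprB. Qed.

Lemma conv_u2 w i :
  conv w (fun l : nat => (if l == 0%N then u20 a b s else - sh l.-1)
                   + w *: ((if l == 0%N then 1%:M else 0) *m s 0)) i
  = - qseq w i.
Proof.
elim: i => [|i /= ->].
  rewrite /= mul1mx /qseq /sb /u20;
  by apply/matrixP=> r c; rewrite !mxE; ring.
rewrite mul0mx scaler0 addr0 shat_sb /qseq /=.
by apply/matrixP=> r c; rewrite !mxE; ring.
Qed.

Lemma qseq_a i : qseq a i = sb i.
Proof. by rewrite /qseq subrr scale0r subr0. Qed.

Lemma Qv_a j : Qv a j = Q2a j.
Proof. by apply: eq_pairing => i _; rewrite qseq_a. Qed.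

Lemma conv_u1 w i :
  conv w (fun l : nat => if l == 0%N then 0 else - s l.-1) i = - zc w 0 i.
Proof. by elim: i => /= [|i ->]; rewrite ?oppr0 // addn0 scalerN opprD. Qed.

(** Links the second kind polynomials of the weights [b - t] and [1]; the term [s i] later
    disappears by orthogonality to [1]. *)
Lemma theta_zc w i : (w - b) *: zc w 0 i = theta w i - s i.
Proof.
elim: i => /= [|i IHi]; first by rewrite scaler0 subrr.
rewrite addn0 scalerDr scalerA mulrC -scalerA IHi /sb.
by apply/matrixP=> r c; rewrite !mxE; ring.
Qed.

Lemma adj_hankel_sb j : (j <= n.+1)%N -> adj (hankel sb j) = hankel sb j.
Proof. by move=> jn; apply: adj_hankel; apply: hermitian_below_le sb_herm; lia. Qed.

Lemma adj_hankel_sh j : (j <= n)%N -> adj (hankel sh j) = hankel sh j.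
Proof. by move=> jn; apply: adj_hankel; apply: hermitian_below_le sh_herm; lia. Qed.

Lemma Gamma1E w j : (j <= n)%N -> Gamma1 b s j w = Gv w j.
Proof.
case: j => [|j] jn; first by rewrite pairing0 /powers expr0.
rewrite [LHS](browYH_Rmx w _ (adj_hankel_sb (leqW jn))).
by apply: eq_pairing => i _; rewrite conv_vmx.
Qed.

Lemma Theta1E w j : (j <= n)%N -> Theta1 b s j w = Tv w j.
Proof.
case: j => [|j] jn; first by rewrite pairing0.
rewrite [LHS](browYH_Rmx w _ (adj_hankel_sb (leqW jn))).
by apply: eq_pairing => i _; rewrite conv_ut1.
Qed.

Lemma P2E w j : (j <= n)%N -> P2 a b s j w = Pv w j.
Proof.
case: j => [|j] jn; first by rewrite pairing0 /powers expr0.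
rewrite [LHS](browYH_Rmx w _ (adj_hankel_sh jn)).
by apply: eq_pairing => i _; rewrite conv_vmx.
Qed.

Lemma u2_bcol w j :
  u2 a b s j + w *: (vmx C q j *m s 0)
  = bcol j.+1 (fun l => (if l == 0%N then u20 a b s else - sh l.-1)
                        + w *: ((if l == 0%N then 1%:M else 0) *m s 0)).
Proof. by rewrite /vmx bcolMr bcolZ /u2 bcolD. Qed.

Lemma Q2E w j : (j <= n)%N -> Q2 a b s j w = Qv w j.
Proof.
case: j => [|j] jn; first by rewrite pairing0 -[RHS]opprK -conv_u2 /= mul1mx.
rewrite /Q2 u2_bcol (browYH_Rmx w _ (adj_hankel_sh jn)).
rewrite -[RHS]opprK; congr (- _); rewrite -scaleN1r -pairingZ; apply: eq_pairing => i _.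
by rewrite conv_u2 scaleN1r.
Qed.

Lemma adj_hankel_s : adj (hankel s n.+1) = hankel s n.+1.
Proof. by apply: adj_hankel; apply: hermitian_below_le s_herm; lia. Qed.

Lemma P1E w : P1 s n.+1 w = pairing n.+1 p1 (powers q w).
Proof.
rewrite [LHS](browYH_Rmx w _ adj_hankel_s).
by apply: eq_pairing => i _; rewrite conv_vmx.
Qed.

Lemma Q1E w : Q1 s n.+1 w = pairing n.+1 p1 (zc w 0).
Proof.
rewrite /Q1 [X in - X](browYH_Rmx w _ adj_hankel_s) -scaleN1r -pairingZ.
by apply: eq_pairing => i _; rewrite conv_u1 scaleN1r opprK.
Qed.

(** * The DSM parameters as kernel increments *)

Lemma muE j : mu a b s j = kernel sb j.+1 (powers q a).
Proof.
rewrite /mu -!mulmxA mulmxA -adjmxM [Rmx _ _ _ *m _]Rmx_mul_bcol mulmxA.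
by rewrite (eq_bcol (fun l _ => conv_vmx a l)).
Qed.

Lemma lambdaE j : lambda a b s j = kernel sh j.+1 (fun i => - sb i).
Proof.
rewrite /lambda -!mulmxA mulmxA -adjmxM u2_bcol Rmx_mul_bcol mulmxA.
rewrite (eq_bcol (g := fun i => - sb i)) // => l _.
by rewrite conv_u2 qseq_a.
Qed.

Lemma mb_kernel j :
  mb a b s j = kernel sb j.+1 (powers q a) - kernel sb j (powers q a).
Proof. by case: j => [|j]; rewrite /mb !muE // kernel0 subr0. Qed.

(** [lb j.+1] is the parameter with index [j]; the empty kernel is zero, which covers [j = 0]. *)
Lemma lb_kernel j :
  lb a b s j.+1
  = kernel sh j.+1 (fun i => - sb i) - kernel sh j (fun i => - sb i).
Proof. by case: j => [|j]; rewrite /lb !lambdaE // kernel0 subr0. Qed.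

Lemma mbE j :
  (j <= n)%N -> mb a b s j = adj (Ga j) *m invmx (adj (Q2a j)).
Proof.
move=> jn; have Gu := Ga_unit jn; have Qu := Q2a_unit jn.
rewrite mb_kernel (kernelS _ _ _ _ (gam_orthogonal jn)); last 3 first.
- by apply: hermitian_below_le sb_herm; lia.
- by apply: sb_unit; lia.
- by apply: sb_unit; lia.
rewrite addrC addKr sqnorm_gam // invmx_mul ?adj_unitmx //.
by rewrite -!mulmxA mulVmx // mulmx1.
Qed.

Lemma lbE j :
  (j < n)%N -> lb a b s j.+1 = - (adj (Q2a j) *m invmx (adj (Ga j.+1))).
Proof.
move=> jn; have jn' := ltnW jn.
have Gu := Ga_unit jn; have Qu := Q2a_unit jn'.
rewrite lb_kernel (kernelS _ _ _ _ (p2_orthogonal jn')); last 3 first.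
- by apply: hermitian_below_le sh_herm; lia.
- by apply: sh_unit; lia.
- by apply: sh_unit; lia.
rewrite addrC addKr sqnorm_p2 // invmx_opp; last first.
  by rewrite unitmx_mul Qu adj_unitmx.
have -> : pairing j (p2 j) (fun i => - sb i) = - Q2a j.
  by rewrite -scaleN1r -pairingZ; apply: eq_pairing => i _; rewrite scaleN1r.
rewrite invmx_mul ?adj_unitmx // adjmxN !(mulNmx, mulmxN) opprK.
by rewrite -!mulmxA mulVmx // mulmx1.
Qed.

Lemma adj_lb j : (j < n)%N -> adj (lb a b s j.+1) = lb a b s j.+1.
Proof.
by move=> jn; rewrite lb_kernel adjmxB !adj_kernel //;
  apply: hermitian_below_le sh_herm; lia.
Qed.

(** * Recurrences in the degree *)

Lemma pairing_powers_sub w j p :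
  pairing j p (fun i => powers q w i.+1 - a *: powers q w i)
  = (w - a) *: pairing j p (powers q w).
Proof.
rewrite -pairingZ; apply: eq_pairing => i _.
by rewrite /powers exprS -scale_scalar_mx -scalerBl.
Qed.

Lemma pairing_theta_sub w j p :
  pairing j p (fun i => theta w i.+1 - a *: theta w i) = - pairing j p (qseq w).
Proof.
rewrite -scaleN1r -pairingZ; apply: eq_pairing => i _.
by apply/matrixP=> r c; rewrite /qseq !mxE; ring.
Qed.

Lemma gam_orthogonal_ltS j k : (j < n)%N -> (k < j)%N ->
  pairing j.+1 (gam j.+1) (fun i => sb (i + k)%N) = 0.
Proof. by move=> jn kj; case: (gam_orthogonal jn) => _ _ ->; rewrite // ltnW. Qed.

Lemma GvS w j : (j < n)%N ->
  Gv w j.+1 = Ga j.+1 *m invmx (Ga j) *m Gv w j + (w - a) *: Pv w j.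
Proof.
move=> jn; have [g1 gd _] := gam_orthogonal jn.
rewrite (christoffel _ (ltnW jn) g1 gd); last by move=> k; apply: gam_orthogonal_ltS.
by rewrite (pairing_powers_sub w j (p2 j)).
Qed.

Lemma TvS w j : (j < n)%N ->
  Tv w j.+1 = Ga j.+1 *m invmx (Ga j) *m Tv w j - Qv w j.
Proof.
move=> jn; have [g1 gd _] := gam_orthogonal jn.
rewrite (christoffel _ (ltnW jn) g1 gd); last by move=> k; apply: gam_orthogonal_ltS.
by rewrite (pairing_theta_sub w j (p2 j)).
Qed.

Lemma QvS w j : (j < n)%N ->
  Qv w j.+1
  = - (w - a) *: Tv w j.+1 + Q2a j.+1 *m invmx (Q2a j) *m Qv w j.
Proof.
move=> jn; rewrite pairing_p2S //; congr (_ + _).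
rewrite pairingB pairingZ scaleNr; have [_ _ g0] := gam_orthogonal jn.
by rewrite -pairing_addn0 g0 // sub0r.
Qed.

(** By [TvS] the increments are the adjoints of the parameters [lb j.+1], which are Hermitian as
    differences of kernels. *)
Lemma invGa_Ta_hermitian j :
  (j <= n)%N -> adj (invmx (Ga j) *m Tv a j) = invmx (Ga j) *m Tv a j.
Proof.
elim: j => [|j IHj] jn.
  by rewrite !pairing0 /powers expr0 invmx1 mul1mx s_herm.
have jn' := ltnW jn; have Gu := Ga_unit jn; have Gu' := Ga_unit jn'.
rewrite TvS // mulmxBr -!mulmxA mulKmx // adjmxB IHj //; congr (_ - _).
rewrite Qv_a; have := adj_lb jn; rewrite lbE // adjmxN => /oppr_inj.
by rewrite adjmxM adj_invmx !adjmxK adjmxM adj_invmx.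
Qed.

(** * The partial products in closed form *)

Definition Pi z w j : 'M[C]_(q + q) :=
  block_mx (adj (Qv w j) *m invmx (adj (Q2a j)))
           (adj (Tv w j) *m invmx (adj (Ga j)))
           (- (z - a) *: (adj (Pv w j) *m invmx (adj (Q2a j))))
           (adj (Gv w j) *m invmx (adj (Ga j))).

(** Induction on [j] with [w] the conjugate of [z]. The right column is updated by [TvS] and [GvS],
    the left one by [QvS] and [pairing_p2S]. *)
Lemma oprod_Pi z w j :
    Num.conj w = z -> (j <= n)%N ->
  oprod j.+1 (fun k =>
    block_mx 1%:M (lb a b s k) 0 1%:M
    *m block_mx 1%:M 0 (- (z - a) *: mb a b s k) 1%:M) = Pi z w j.
Proof.
move=> conj_w; elim: j => [|j IHj] jn.
  have := Q2a_unit (leq0n n).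
  rewrite oprodS [oprod 0 _]/(1%:M) mul1mx mbE // /Pi !pairing0 /powers !expr0 adjmx1 invmx1.
  rewrite s_herm // sb_herm // /qseq /= !mulmx_block => sbu.
  rewrite !(mul1mx, mulmx1, mul0mx, mulmx0, addr0, add0r).
  rewrite adjmxB adjmxZ (conj_sub conj_w a_real) s_herm // sb_herm //.
  by rewrite mulmxBl mulmxV // scaleNr mulmxN -scalemxAl -scalemxAr.
have jn' := ltnW jn.
have aGu : adj (Ga j.+1) \in unitmx by rewrite adj_unitmx Ga_unit.
have aQu : adj (Q2a j.+1) \in unitmx by rewrite adj_unitmx Q2a_unit.
have aQu' : adj (Q2a j) \in unitmx by rewrite adj_unitmx Q2a_unit.
have T_eq : adj (Qv w j) *m invmx (adj (Q2a j)) *m lb a b s j.+1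
    + adj (Tv w j) *m invmx (adj (Ga j)) = adj (Tv w j.+1) *m invmx (adj (Ga j.+1)).
  rewrite (TvS w jn) adjmxB !adjmxM adj_invmx mulmxBl mulmxA (mulmxK aGu).
  by rewrite (lbE jn) mulmxN mulmxA (mulmxKV aQu') addrC.
have G_eq : - (z - a) *: (adj (Pv w j) *m invmx (adj (Q2a j))) *m lb a b s j.+1
    + adj (Gv w j) *m invmx (adj (Ga j)) = adj (Gv w j.+1) *m invmx (adj (Ga j.+1)).
  rewrite (GvS w jn) adjmxD !adjmxM adjmxZ (conj_sub conj_w a_real) adj_invmx mulmxDl.
  rewrite [in RHS]mulmxA (mulmxK aGu) (lbE jn) mulmxN -!scalemxAl.
  by rewrite [in LHS]mulmxA (mulmxKV aQu') addrC scaleNr opprK.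
(* The factor [adj (Ga j.+1)] in [mbE] cancels the normalization of the right column and leaves that
   of the left one. *)
have e_eq (A : 'M[C]_q) : A *m invmx (adj (Ga j.+1)) *m (- (z - a) *: mb a b s j.+1)
    = - (z - a) *: (A *m invmx (adj (Q2a j.+1))).
  by rewrite mbE // -scalemxAr mulmxA mulmxKV.
rewrite oprodS (IHj jn') block_unipotent_step T_eq G_eq !e_eq /Pi.
congr block_mx.
  rewrite (QvS w jn) adjmxD adjmxZ rmorphN /= (conj_sub conj_w a_real) !adjmxM adj_invmx.
  by rewrite mulmxDl -scalemxAl mulmxA (mulmxK aQu) addrC.
rewrite -scalerDr (pairing_p2S (powers q w) jn) adjmxD !adjmxM adj_invmx mulmxDl mulmxA.
by rewrite (mulmxK aQu) [X in _ *: X]addrC.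
Qed.

(** * The polynomial [P1 n.+1] and the last factor *)

Hypothesis s_unit : hankel s n.+1 \in unitmx.

Lemma p1_orthogonal : monic_orthogonal s n.+1 p1.
Proof. exact: opol_orthogonal. Qed.

Local Notation P1v w := (pairing n.+1 p1 (powers q w)).
Local Notation Q1v w := (pairing n.+1 p1 (zc w 0)).

(** Multiplication by [b - t] raises the degree by one, which costs one orthogonality relation:
    [k < n] instead of [k < n.+1]. *)
Lemma p1_orthogonal_sb k : (k < n)%N -> pairing n.+1 p1 (fun i => sb (i + k)%N) = 0.
Proof.
move=> kn; have [_ _ p0] := p1_orthogonal; rewrite pairingB pairingZ (p0 _ (leqW kn)).
rewrite scaler0 sub0r -oppr0 -(p0 _ (kn : k.+1 < n.+1)%N); congr (- _).
by apply: eq_pairing => i _; rewrite addnS.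
Qed.

Lemma P1v_christoffel w :
  P1v w = P1v a *m invmx (Ga n) *m Gv w n + (w - a) *: Pv w n.
Proof.
have [p1' pd _] := p1_orthogonal.
rewrite (christoffel _ (leqnn n) p1' pd); last exact: p1_orthogonal_sb.
by rewrite (pairing_powers_sub w n (p2 n)).
Qed.

Lemma Q1v_christoffel w :
  (w - b) *: Q1v w = P1v a *m invmx (Ga n) *m Tv w n - Qv w n.
Proof.
have [p1' pd p0] := p1_orthogonal.
rewrite -pairing_theta_sub -christoffel //; last exact: p1_orthogonal_sb.
rewrite -[RHS]subr0 -(p0 0%N) // pairing_addn0 -pairingB -pairingZ.
by apply: eq_pairing => i _; rewrite theta_zc.
Qed.

Lemma zcSl k i : zc a k.+1 i = a *: zc a k i - a ^+ i *: s k + s (i + k)%N.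
Proof.
elim: i => [|i IHi] /=; first by rewrite expr0 scaler0 scale1r sub0r addNr.
by rewrite IHi addnS addSn exprS; apply/matrixP=> r c; rewrite !mxE; ring.
Qed.

(** With [L] the moment functional, [zc a k i] is [L(t^k (a^i - t^i) / (a - t))]; on the left the
    terms [t^(k+i)] cancel. *)
Lemma zc_swap k i :
  zc a k i - zc a i k = a ^+ k *: zc a 0 i - a ^+ i *: zc a 0 k.
Proof.
elim: k => [|k IHk] /=; first by rewrite expr0 scale1r scaler0.
rewrite zcSl addn0 addnC opprD addrACA addrA.
rewrite [X in _ = X](_ : _ = a *: (a ^+ k *: zc a 0 i - a ^+ i *: zc a 0 k) - a ^+ i *: s k).
  by rewrite -IHk; apply/matrixP=> r c; rewrite !mxE [(k + i)%N]addnC; ring.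
by apply/matrixP=> r c; rewrite !mxE exprS; ring.
Qed.

Lemma adj_zc k i :
  (k <= n.+1)%N -> (i <= n.+1)%N -> adj (zc a k i) = zc a k i.
Proof.
move=> kn; elim: i => /= [|i IHi] i_n; first by rewrite adjmx0.
rewrite adjmxD adjmxZ /= (CrealP a_real) IHi 1?ltnW // s_herm //; lia.
Qed.

(** As a function of [i], [zc a i k] is a moment sequence for [t^i] times a polynomial of degree
    below [k], so orthogonality of [p1] applies. *)
Lemma pairing_p1_zc k : (k <= n.+1)%N -> pairing n.+1 p1 (fun i => zc a i k) = 0.
Proof.
have [_ _ p0] := p1_orthogonal.
elim: k => [|k IHk] kn; first by rewrite [LHS]big1 // => i _; rewrite mulmx0.
rewrite pairingD pairingZ IHk 1?ltnW // scaler0 add0r.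
by rewrite -(p0 k kn); apply: eq_pairing => i _; rewrite addnC.
Qed.

(* By zc_swap the difference of the two sides splits into two double sums that
   vanish by orthogonality. *)
Lemma Q1v_P1v_hermitian :
  adj (Q1v a *m adj (P1v a)) = Q1v a *m adj (P1v a).
Proof.
have QPE : Q1v a *m adj (P1v a)
    = \sum_(k < n.+2) \sum_(i < n.+2) a ^+ k *: (p1 i *m zc a 0 i *m adj (p1 k)).
  rewrite adj_pairing_powers // mulmx_sumr; apply: eq_bigr => k _.
  by rewrite -scalemxAr mulmx_suml scaler_sumr.
have PQE : adj (Q1v a *m adj (P1v a))
    = \sum_(k < n.+2) \sum_(i < n.+2) a ^+ i *: (p1 i *m zc a 0 k *m adj (p1 k)).
  rewrite QPE exchange_big adjmx_sum; apply: eq_bigr => i _.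
  rewrite adjmx_sum; apply: eq_bigr => k _.
  rewrite adjmxZ rmorphXn /= (CrealP a_real) !adjmxM adjmxK mulmxA adj_zc //.
  by rewrite -ltnS.
have zc_pairing (k : 'I_n.+2) : pairing n.+1 p1 (fun i => zc a i k) = 0.
  by rewrite pairing_p1_zc // -ltnS.
have zc_left : \sum_(k < n.+2) \sum_(i < n.+2) p1 i *m zc a i k *m adj (p1 k) = 0.
  by apply: big1 => k _; rewrite -mulmx_suml [X in X *m _]zc_pairing mul0mx.
have zc_right : \sum_(k < n.+2) \sum_(i < n.+2) p1 i *m zc a k i *m adj (p1 k) = 0.
  rewrite -[RHS](adjmx0 C) -[X in adj X]zc_left exchange_big adjmx_sum.
  apply: eq_bigr => i _; rewrite adjmx_sum; apply: eq_bigr => k _.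
  by rewrite !adjmxM adjmxK mulmxA adj_zc // -ltnS.
apply/eqP; rewrite eq_sym -subr_eq0 PQE QPE -sumrB.
rewrite -[X in _ == X]subr0 -[X in X - _]zc_right -[X in _ - X]zc_left -sumrB.
apply/eqP/eq_bigr => k _; rewrite -!sumrB; apply: eq_bigr => i _.
by rewrite -!mulmxBl -!mulmxBr zc_swap mulmxBr mulmxBl -!scalemxAr -!scalemxAl.
Qed.

Definition shift_param : 'M[C]_q :=
  - (invmx (Ga n) *m Tv a n) - (b - a) *: (invmx (P1v a) *m Q1v a).

Lemma shift_paramE :
  P1v a \in unitmx -> shift_param = - (invmx (P1v a) *m Q2a n).
Proof.
move=> Pu; have := Q1v_christoffel a; rewrite Qv_a => /(congr1 (mulmx (invmx (P1v a)))).
rewrite mulmxBr -!mulmxA mulKmx // -scalemxAr => QT.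
by rewrite /shift_param -scaleNr opprB QT addKr.
Qed.

(** [U] contains the inverse of the adjoint of [P1v a], the last factor the inverse of [P1v a]
    itself; Hermitian symmetry of both summands reconciles them. *)
Lemma adj_shift_param : P1v a \in unitmx -> adj shift_param = shift_param.
Proof.
move=> Pu; have aPu : adj (P1v a) \in unitmx by rewrite adj_unitmx.
rewrite /shift_param adjmxB adjmxN invGa_Ta_hermitian // adjmxZ.
rewrite rmorphB /= (CrealP a_real) (CrealP b_real); congr (_ - _ *: _).
have := Q1v_P1v_hermitian; rewrite adjmxM adjmxK => QP.
by rewrite adjmxM adj_invmx -[LHS](mulKmx Pu) (mulmxA (P1v a)) QP -!mulmxA mulmxV // mulmx1.
Qed.

Lemma U_factorization z w :
    Num.conj w = z -> P1v a \in unitmx -> z != b ->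
  U a b s n z
  = block_mx ((b - z)^-1 *: 1%:M) 0 0 1%:M *m Pi z w n
    *m block_mx 1%:M shift_param 0 1%:M *m block_mx ((b - z) *: 1%:M) 0 0 1%:M.
Proof.
move=> conj_w Pu zb; have bz0 : b - z != 0 by rewrite subr_eq0 eq_sym.
have aGu : adj (Ga n) \in unitmx by rewrite adj_unitmx Ga_unit.
have aQu : adj (Q2a n) \in unitmx by rewrite adj_unitmx Q2a_unit.
have aPu : adj (P1v a) \in unitmx by rewrite adj_unitmx.
have XE : shift_param = - (adj (Q2a n) *m invmx (adj (P1v a))).
  by rewrite -adj_shift_param // shift_paramE // adjmxN adjmxM adj_invmx.
have Q2aE : Q2 a b s n a = Q2a n by rewrite Q2E ?Qv_a.
have wE : Num.conj z = w by rewrite -conj_w conjCK.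
rewrite /U wE /Pi Q2aE !P1E !Q1E (P2E _ (leqnn n)) (Q2E _ (leqnn n)) !mulmx_block.
rewrite !(mul1mx, mulmx1, mul0mx, mulmx0, addr0, add0r).
rewrite -!scalemxAl !mul1mx -!scalemxAr !mulmx1; congr block_mx.
- by rewrite scalerA ?mulfV ?mulVf // scale1r.
- rewrite XE mulmxN mulmxA (mulmxKV aQu) -scalerDr.
  (* The relation for [Q1v] carries the factor [w - b], so [b - z] and its inverse are inserted. *)
  rewrite -[LHS]scale1r -(mulVf bz0) -scalerA; congr (_ *: _).
  have := congr1 (@adj _ _ _) (Q1v_christoffel w).
  rewrite adjmxZ (conj_sub conj_w b_real) adjmxB !adjmxM adj_invmx => QE.
  rewrite scalerN -scaleNr opprB scalemxAl QE mulmxBl mulmxA (mulmxK aPu).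
  by rewrite addrC.
- by rewrite scalerA mulNr.
rewrite XE mulmxN mulmxA (mulmxKV aQu) scalerN scaleNr opprK.
rewrite (P1v_christoffel w) adjmxD adjmxZ (conj_sub conj_w a_real) !adjmxM adj_invmx.
by rewrite mulmxDl [X in X *m _ + _ = _]mulmxA (mulmxK aPu) addrC -scalemxAl.
Qed.

End Recurrences.

Theorem mainTheorem7 (C : numClosedFieldType) (q n : nat) (a b : C)
  (s : nat -> 'M[C]_q) :
  (0 < q)%N -> (1 <= n)%N ->
  a \is Num.real -> b \is Num.real -> a < b ->
  (forall j, (j <= 2 * n + 1)%N -> adj (s j) = s j) ->
  posdef (H1 s n) -> posdef (H2 a b s n.-1) ->
  posdef (K1 b s n) -> posdef (K2 a s n) ->
  P1 s n.+1 a \in unitmx ->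
  forall z : C, z != b ->
  U a b s n z =
    block_mx ((b - z)^-1 *: 1%:M) 0 0 1%:M
    *m oprod n.+1 (fun k =>
         block_mx 1%:M (lb a b s k) 0 1%:M
         *m block_mx 1%:M 0 (- (z - a) *: mb a b s k) 1%:M)
    *m block_mx 1%:M
         (- (invmx (Gamma1 b s n a) *m Theta1 b s n a)
          - (b - a) *: (invmx (P1 s n.+1 a) *m Q1 s n.+1 a)) 0 1%:M
    *m block_mx ((b - z) *: 1%:M) 0 0 1%:M.
Proof.
move=> _ n_gt0 a_real b_real _ sH H1pos H2pos K1pos _ P1u z zb.
have s_herm : hermitian_below s n.+1.*2 by move=> i i_lt; apply: sH; lia.
have sb_unit j : (j <= n.+1)%N -> hankel (sb b s) j \in unitmx.
  by move=> jn; apply: posdef_bmx_unit jn K1pos.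
have sh_unit j : (j <= n)%N -> hankel (shat a b s) j \in unitmx.
  (* [H2 a b s n.-1] has [n.-1.+1 = n] block rows. *)
  by rewrite -(prednK n_gt0) => jn; apply: posdef_bmx_unit jn H2pos.
have s_unit : hankel s n.+1 \in unitmx by apply: posdef_bmx_unit (leqnn _) H1pos.
rewrite (oprod_Pi a_real b_real s_herm sb_unit sh_unit (conjCK z)) //.
rewrite !(Gamma1E a_real b_real s_herm) // !(Theta1E a_real b_real s_herm) //.
move: P1u; rewrite !(P1E a_real b_real s_herm) !(Q1E a_real b_real s_herm) => P1u.
exact: (U_factorization a_real b_real s_herm sb_unit sh_unit s_unit (conjCK z)).
Qed.
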